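(* Let $X$ be a Hausdorff compact space, $\alpha:X\to X$ a continuous mapping, and $A:C(X)\to C(X)$ a transfer operator for $(X,\alpha)$. Then for any measure $\mu\in M$ and any real number $t>\tau(\mu)$ there exist a neighborhood $O(\mu)$ of $\mu$ in $M$ in the $^*$-weak topology, a number $C(t,\mu)$, and a sequence of functions $\chi_n\in C(X)$ majorizing the index (characteristic) functions of the sets $X_n(O(\mu))$, such that for all $n$ $$\|A^n\chi_n\|\le C(t,\mu)\,e^{nt}.$$
   Context: $C(X)$ is the algebra of continuous real-valued functions on $X$ with the uniform norm; $\mathbf 1$ is the unit function. A linear operator $A:C(X)\to C(X)$ is a transfer operator for $(X,\alpha)$ if it is positive (maps nonnegative functions to nonnegative functions) and satisfies $A\bigl((f\circ\alpha)\,g\bigr)=f\,Ag$ for all $f,g\in C(X)$. $M$ is the set of all positive linear functionals $\mu$ on $C(X)$ with $\mu(\mathbf 1)=1$ (identified with regular Borel probability measures on $X$), endowed with the $^*$-weak topology of the dual of $C(X)$. For $x\in X$ the empirical measure $\delta_{x,n}\in M$ is $$\delta_{x,n}(f)=\frac1n\bigl(f(x)+f(\alpha(x))+\dots+f(\alpha^{n-1}(x))\bigr),\qquad f\in C(X).$$ For a neighborhood $O(\mu)\subset M$ of $\mu$ put $X_n(O(\mu)):=\{x\in X:\delta_{x,n}\in O(\mu)\}$. A partition of unity in $C(X)$ is a finite set $D=\{g_1,\dots,g_k\}$ of nonnegative functions in $C(X)$ with $g_1+\dots+g_k\equiv 1$. For every $\mu\in M$ (not necessarily $\alpha$-invariant)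 the $t$-entropy is $$\tau(\mu):=\inf_{n\in\mathbb N}\frac{\tau_n(\mu)}{n},\qquad \tau_n(\mu):=\inf_D\tau_n(\mu,D),\qquad \tau_n(\mu,D):=\sup_{m\in M}\sum_{g\in D}\mu(g)\ln\frac{m(A^ng)}{\mu(g)},$$ where the infimum is over all partitions of unity $D$ in $C(X)$; a summand with $\mu(g)=0$ is set to be zero regardless of $m(A^ng)$; and if for some $g\in D$ one has $A^ng\equiv0$ and $\mu(g)>0$, then $\tau(\mu)=-\infty$ (consistently with $\ln0=-\infty$). *)

(* Defs.v *)
From HB Require Import structures.
From mathcomp Require Import all_boot all_order all_algebra.
From mathcomp Require Import finmap.
From mathcomp Require Import all_classical all_reals all_analysis.

Set Implicit Arguments.
Unset Strict Implicit.
Unset Printing Implicit Defensive.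

Import Order.TTheory GRing.Theory Num.Theory.
Import numFieldNormedType.Exports.

Local Open Scope classical_set_scope.
Local Open Scope ring_scope.

(* [continuousType X R] is made a commutative ring and an R-module with the
   pointwise operations, as a substructure of [X -> R]. The ring is only
   [comPzRingType], because [X] may be empty. *)
Section continuous_algebra.
Variables (X : topologicalType) (R : realType).

Definition continuous_pred : {pred X -> R} :=
  mem [set f : X -> R | continuous f].

Section Sub.
Variables (f : X -> R) (fP : f \in continuous_pred).
Definition continuous_Sub : continuousType X R := mkcts (set_mem fP).
End Sub.

Lemma continuous_rect (K : continuousType X R -> Type) :
  (forall f (fP : f \in continuous_pred), K (continuous_Sub fP)) ->
  forall u, K u.
Proof.
move=> Ksub u.
have uP : (u : X -> R) \in continuous_pred by apply/mem_set; exact: cts_fun.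
have <- : continuous_Sub uP = u by apply/continuousEP.
exact: Ksub.
Qed.

Lemma continuous_valP f (fP : f \in continuous_pred) :
  continuous_Sub fP = f :> (X -> R).
Proof. by []. Qed.

HB.instance Definition _ :=
  isSub.Build _ _ (continuousType X R) continuous_rect continuous_valP.

Lemma continuous_subring_closed : subring_closed continuous_pred.
Proof.
split=> [|f g /set_mem cf /set_mem cg|f g /set_mem cf /set_mem cg];
  apply/mem_set => x.
- exact: cvg_cst.
- by apply: cvgB; [exact: cf|exact: cg].
- by apply: cvgM; [exact: cf|exact: cg].
Qed.

Lemma continuous_submod_closed : submod_closed continuous_pred.
Proof.
split=> [|a f g /set_mem cf /set_mem cg]; apply/mem_set => x.
- exact: cvg_cst.
- by apply: cvgD; [apply: cvgZr; exact: cf|exact: cg].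
Qed.

HB.instance Definition _ :=
  GRing.isSubringClosed.Build _ continuous_pred continuous_subring_closed.
HB.instance Definition _ :=
  GRing.isSubmodClosed.Build _ _ continuous_pred continuous_submod_closed.

HB.instance Definition _ :=
  GRing.SubChoice_isSubComPzRing.Build (X -> R) continuous_pred
    (continuousType X R) continuous_subring_closed.
HB.instance Definition _ :=
  [SubZmodule_isSubLmodule of continuousType X R by <:].

End continuous_algebra.

Notation "{ 'cts' X -> Y }" := (continuousType X Y)
  (X at level 98, Y at level 99, format "{ 'cts'  X  ->  Y }") : type_scope.

Section transfer.
Variables (X : topologicalType) (R : realType).

(* The set is empty when [X] is, and then [sup_norm f = 0]. *)
Definition sup_norm (f : {cts X -> R}) : R := sup [set `|f x| | x in [set: X]].

Definition transfer_operator (alpha : {cts X -> X})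
    (A : {linear {cts X -> R} -> {cts X -> R}}) : Prop :=
  (forall f : {cts X -> R}, (forall x, 0 <= f x) -> forall x, 0 <= A f x) /\
  (forall f g : {cts X -> R}, A ((f \o alpha : {cts X -> R}) * g) = f * A g).

End transfer.

(* The set [M] of normalized positive functionals; [{scalar V}] is the type of
   linear functionals on [V]. *)
Record pmean (X : topologicalType) (R : realType) := PMean {
  pmean_fun :> {scalar {cts X -> R}} ;
  pmean_ge0 : forall f : {cts X -> R}, (forall x, 0 <= f x) -> 0 <= pmean_fun f ;
  pmean1 : pmean_fun 1 = 1 }.

Section weak_star.
Variables (X : topologicalType) (R : realType).

Definition pmean_eval (mu : pmean X R) : {ptws {cts X -> R} -> R} :=
  fun f => mu f.

HB.instance Definition _ := gen_eqMixin (pmean X R).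
HB.instance Definition _ := gen_choiceMixin (pmean X R).

(* The weak-* topology: the topology of pointwise convergence on C(X). *)
HB.instance Definition _ :=
  Topological.copy (pmean X R) (initial_topology pmean_eval).

End weak_star.

Section empirical.
Variables (X : topologicalType) (R : realType) (alpha : {cts X -> X}).

Definition empirical_fun (x : X) (n : nat) (f : {cts X -> R}) : R :=
  n%:R^-1 * \sum_(i < n) f (iter i alpha x).

Lemma empirical_fun_is_scalar x n : scalar (empirical_fun x n).
Proof.
move=> a f g; rewrite /empirical_fun mulrCA -mulrDr; congr (_ * _).
by rewrite mulr_sumr -big_split.
Qed.

HB.instance Definition _ x n :=
  GRing.isLinear.Build R {cts X -> R} R _ (empirical_fun x n)
    (empirical_fun_is_scalar x n).

Lemma empirical_fun_ge0 x n (f : {cts X -> R}) :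
  (forall y, 0 <= f y) -> 0 <= empirical_fun x n f.
Proof.
by move=> f0; rewrite mulr_ge0 ?invr_ge0 ?ler0n// sumr_ge0.
Qed.

Lemma empirical_fun1 x n : (0 < n)%N -> empirical_fun x n 1 = 1.
Proof.
move=> n0; rewrite /empirical_fun sumr_const card_ord mulVf//.
by rewrite pnatr_eq0 -lt0n.
Qed.

Definition empirical (x : X) (n : nat) (n0 : (0 < n)%N) : pmean X R :=
  PMean (@empirical_fun_ge0 x n) (empirical_fun1 x n0).

Definition empirical_set (n : nat) (n0 : (0 < n)%N) (O : set (pmean X R)) :
  set X := [set x | O (empirical x n0)].

End empirical.

Section t_entropy.
Variables (X : topologicalType) (R : realType).
Variable A : {linear {cts X -> R} -> {cts X -> R}}.
Local Open Scope ereal_scope.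

Definition partition_of_unity : set {fset {cts X -> R}} :=
  [set D : {fset {cts X -> R}} |
     (forall g : {cts X -> R}, g \in D -> forall x, (0 <= g x)%R) /\
     (\sum_(g <- D) g)%R = 1%R :> {cts X -> R}].

(* [lne r%:E = -oo] for [r <= 0], so a summand with [mu g > 0] and
   [m (A^n g) = 0] is -oo; no summand is ever +oo. *)
Definition tau_summand (mu m : pmean X R) (n : nat) (g : {cts X -> R}) : \bar R :=
  if mu g == 0%R then 0
  else (mu g)%:E * lne (m (iter n A g) / mu g)%:E.

Definition tau_part (mu : pmean X R) (n : nat) (D : {fset {cts X -> R}}) : \bar R :=
  ereal_sup [set \sum_(g <- D) tau_summand mu m n g | m in [set: pmean X R]].

Definition tau_n (mu : pmean X R) (n : nat) : \bar R :=
  ereal_inf [set tau_part mu n D | D in partition_of_unity].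

Definition t_entropy (mu : pmean X R) : \bar R :=
  ereal_inf [set (n%:R^-1)%:E * tau_n mu n | n in [set n : nat | (0 < n)%N]].

End t_entropy.

(* Main.v *)
(* Since t > tau(mu), some N and some partition of unity D satisfy
     sup_m sum_g mu(g) ln (m(A^N g) / mu(g)) < N t.
   The first-order condition at a near-maximizer m0, tested on Dirac measures,
   yields weights c_g > 0, essentially mu(g) / m0(A^N g), with
   A^N (sum_g c_g g) <= 1 and sum_g mu(g) ln c_g > - N t. By concavity of the
   logarithm l := sum_g (ln c_g) g satisfies A^N (exp l) <= 1, while
   mu(l) > - N t. Iterating the transfer identity along each residue class of
   times mod N bounds A^n exp ((1/N) sum_(k < n) l o alpha^k) uniformly in n.
   So one takes O(mu) := {m | m(l) > - N t} and
   chi_n := e^(n t) exp ((1/N) sum_(k < n) l o alpha^k), which is at least 1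
   at x as soon as delta_(x,n)(l) > - N t. *)
Require Import Defs.
From HB Require Import structures.
From mathcomp Require Import all_boot all_order all_algebra.
From mathcomp Require Import finmap.
From mathcomp Require Import all_classical all_reals all_analysis.
From mathcomp Require Import ring lra.
Set Implicit Arguments.
Unset Strict Implicit.
Unset Printing Implicit Defensive.

Import Order.TTheory GRing.Theory Num.Theory.
Import numFieldNormedType.Exports.
Local Open Scope classical_set_scope.
Local Open Scope ring_scope.

(** * Convexity inequalities and near-maximizers of a weighted logarithm *)

Lemma ln1D_ge (R : realType) (u : R) :
  - 2^-1 <= u -> u - 2 * u ^+ 2 <= ln (1 + u).
Proof.
move=> hu.
have u1 : 0 < 1 + u by lra.
(* The bound [ln y <= y - 1] at [y = (1 + u)^-1] gives [ln (1 + u) >= u / (1 + u)], and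
   [1 + u >= 1 / 2] does the rest. *)
have : ln (1 + u)^-1 <= (1 + u)^-1 - 1.
  have := @le_ln1Dx R ((1+u)^-1 - 1).
  rewrite addrCA subrr addr0; apply.
  by rewrite ltrBrDl subrr invr_gt0.
rewrite lnV ?posrE// => h.
have -> : ln (1 + u) = - - ln (1+u) by rewrite opprK.
rewrite lerNr (le_trans h)// lerBlDr -div1r ler_pdivrMr//.
nra.
Qed.

(** Each [expR (y i)] lies above the tangent of [expR] at the mean [z]; the linear terms cancel on
    averaging. *)
Lemma expR_convex_comb (R : realType) (I : finType) (p y : I -> R) :
  (forall i, 0 <= p i) -> \sum_i p i = 1 ->
  expR (\sum_i p i * y i) <= \sum_i p i * expR (y i).
Proof.
move=> p0 p1; set z := \sum_i p i * y i.
have h i : p i * (expR z * (1 + (y i - z))) <= p i * expR (y i).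
  rewrite ler_wpM2l// -[X in _ <= expR X](subrKC z) expRD.
  by rewrite ler_wpM2l ?expR_ge0// expR_ge1Dx.
apply: le_trans (ler_sum _ (fun i _ => h i)).
under eq_bigr do rewrite mulrCA.
rewrite -mulr_sumr.
under eq_bigr do rewrite mulrDr mulr1 mulrBr.
by rewrite big_split/= sumrB -mulr_suml p1 mul1r -/z subrr addr0 mulr1.
Qed.

(* Take for [v0] a near-maximizer of [v |-> sum p ln v]: the bound is the
   first-order optimality condition along the segment from [v0] to [v]. *)
Lemma log_optimal_approx (R : realType) (I : finType) (p : I -> R)
    (P : set (I -> R)) (e B g : R) :
  (forall i, 0 <= p i) -> \sum_i p i = 1 -> 0 < e -> 0 < g ->
  P !=set0 ->
  (forall v i, P v -> e <= v i <= B) ->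
  (forall v w s, P v -> P w -> 0 <= s <= 1 ->
     P (fun i => (1 - s) * v i + s * w i)) ->
  exists2 v0, P v0 & forall v, P v -> \sum_i p i * (v i / v0 i) <= 1 + g.
Proof.
move=> p0 p1 e0 g0 [u Pu] Pb Pc.
pose F v := \sum_i p i * ln (v i).
have Pgt v i : P v -> 0 < v i.
  by move=> Pv; have /andP[+ _] := Pb v i Pv; exact: lt_le_trans.
pose S := [set F v | v in P].
have hS : has_sup S.
  split; first by exists (F u), u.
  exists (\sum_i p i * ln B) => _ [v Pv <-].
  apply: ler_sum => i _; rewrite ler_wpM2l//.
  have /andP[_ vB] := Pb v i Pv.
  by rewrite ler_ln ?posrE ?(lt_le_trans _ vB) ?Pgt.
(* The ratios [r i] will lie in [[0, B / e]], so [K] bounds [|r i - 1|]. The defect [s ^+ 2] of the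
   near-maximizer and the second-order error [2 * s ^+ 2 * K ^+ 2] then add up to at most [s * g],
   and dividing by [s] leaves [g]. *)
pose K := B / e + 1.
have K0 : 0 < 1 + 2 * K ^+ 2.
  by rewrite ltr_wpDr// mulr_ge0// sqr_ge0.
pose s := Num.min 2^-1 (g / (1 + 2 * K ^+ 2)).
have s0 : 0 < s by rewrite lt_min divr_gt0// invr_gt0 ltr0n.
have s2 : s <= 2^-1 by rewrite ge_min lexx.
have sg : s * (1 + 2 * K ^+ 2) <= g by rewrite -ler_pdivlMr// ge_min lexx orbT.
have [_ [v0 Pv0 <-] hv0] := sup_adherent (exprn_gt0 2 s0) hS.
exists v0 => // v Pv.
pose r i := v i / v0 i.
pose w i := (1 - s) * v0 i + s * v i.
have Pw : P w by apply: Pc => //; lra.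
have Fw : F w <= F v0 + s ^+ 2.
  rewrite (le_trans (ub_le_sup hS.2 _))//; first by exists w.
  by rewrite ltW// -ltrBlDr.
have rb i : 0 <= r i <= B / e.
  have /andP[e1 e2] := Pb v i Pv; have /andP[f1 f2] := Pb v0 i Pv0.
  have [r0 s0'] := (ltW (Pgt v i Pv), ltW (Pgt v0 i Pv0)).
  by rewrite divr_ge0//= ler_pM ?invr_ge0// lef_pV2 ?posrE ?(Pgt v0)//.
have lw i : ln (v0 i) + (s * (r i - 1) - 2 * s ^+ 2 * K ^+ 2) <= ln (w i).
  have -> : w i = v0 i * (1 + s * (r i - 1)).
    by rewrite /w /r; field; rewrite gt_eqF ?Pgt.
  have /andP[r0 r1] := rb i.
  have u2 : - 2^-1 <= s * (r i - 1) by nra.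
  have u1 : 0 < 1 + s * (r i - 1) by lra.
  rewrite lnM ?posrE ?Pgt// lerD2l (le_trans _ (ln1D_ge u2))//.
  rewrite lerB// exprMn mulrA ler_wpM2l ?mulr_ge0 ?sqr_ge0 ?(ltW s0)//.
  by rewrite /K; nra.
have : F v0 + (s * (\sum_i p i * r i - 1) - 2 * s ^+ 2 * K ^+ 2) <= F w.
  apply: le_trans (ler_sum _ (fun i _ => ler_wpM2l (p0 i) (lw i))).
  under [leRHS]eq_bigr do rewrite mulrDr.
  rewrite big_split/= lerD2l.
  rewrite [leRHS](eq_bigr
    (fun i => s * (p i * r i) - (s + 2 * s ^+ 2 * K ^+ 2) * p i)).
    by rewrite sumrB -!mulr_sumr p1; lra.
  by move=> i _; ring.
move=> /le_trans/(_ Fw); rewrite lerD2l -/r => h.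
rewrite -(ler_pM2l s0) -/(r _).
move: h sg; set x := \sum_i _; set k := K ^+ 2 => h sg; nra.
Qed.

(** * Bounds on continuous functions and constructions of normalized positive functionals *)

Lemma cts_bounded (R : realType) (X : topologicalType) (f : {cts X -> R}) :
  compact [set: X] -> exists2 B, 0 < B & forall x, f x <= B.
Proof.
move=> cX; have [X0|/nonemptyPn X0] := pselect ([set: X] !=set0); last first.
  by exists 1 => // x; suff : set0 x by []; rewrite -X0.
have cf : {within [set: X], continuous f}.
  by apply: continuous_subspaceT => x; exact: cts_fun.
have [c _ hc] := compact_EVT_max X0 cX cf.
exists (Num.max 1 (f c)) => [|x]; first by rewrite lt_max ltr01.
by rewrite le_max hc ?orbT// in_setT.
Qed.

Lemma cts_sumE (R : realType) (X : topologicalType) (I : Type) (r : seq I)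
    (P : pred I) (F : I -> {cts X -> R}) x :
  (\sum_(i <- r | P i) F i) x = \sum_(i <- r | P i) F i x.
Proof. by apply: (big_morph (fun f : {cts X -> R} => f x)). Qed.

Section pmean_constructions.
Variables (R : realType) (X : topologicalType).
Implicit Types (m : pmean X R) (s : R).

Lemma pmean_nonempty m : [set: X] !=set0.
Proof.
apply: contrapT => /nonemptyPn X0.
have : (1 : {cts X -> R}) = 0.
  by apply/continuousEP => x; suff : set0 x by []; rewrite -X0.
move=> h; have := pmean1 m; rewrite h linear0 => /eqP.
by rewrite eq_sym oner_eq0.
Qed.

Lemma pmean_le m (f g : {cts X -> R}) : (forall x, f x <= g x) -> m f <= m g.
Proof.
move=> fg; rewrite -subr_ge0 -linearB pmean_ge0// => x.
by have := fg x; rewrite -subr_ge0.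
Qed.

Lemma pmean_bound m (f : {cts X -> R}) (B : R) : (forall x, f x <= B) -> m f <= B.
Proof.
move=> fB; have /le_trans : m f <= m (B *: (1 : {cts X -> R})).
  by apply: pmean_le => x; rewrite (le_trans (fB x))// -[leLHS]mulr1.
by apply; rewrite linearZ/= pmean1 mulr1.
Qed.

Lemma pmean_dirac (x : X) : exists m, forall f, m f = f x.
Proof.
exists (empirical R idfun x (ltn0Sn 0)) => f.
by rewrite /= /empirical_fun invr1 mul1r big_ord1.
Qed.

Definition conv_fun m m' s (f : {cts X -> R}) : R := (1 - s) * m f + s * m' f.

Lemma conv_fun_is_scalar m m' s : scalar (conv_fun m m' s).
Proof. by move=> a f g; rewrite /conv_fun !linearP; ring. Qed.

HB.instance Definition _ m m' s := GRing.isLinear.Build R {cts X -> R} R _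
  (conv_fun m m' s) (conv_fun_is_scalar m m' s).

Lemma pmean_conv m m' s : 0 <= s <= 1 ->
  exists m'', forall f, m'' f = (1 - s) * m f + s * m' f.
Proof.
move=> /andP[s0 s1].
have h0 (f : {cts X -> R}) : (forall x, 0 <= f x) -> 0 <= conv_fun m m' s f.
  by move=> f0; rewrite addr_ge0// mulr_ge0 ?subr_ge0 ?pmean_ge0.
have h1 : conv_fun m m' s 1 = 1 by rewrite /conv_fun !pmean1; ring.
by exists (PMean h0 h1).
Qed.

(** Averaging successively with Dirac functionals at points where [a i] is positive: each halving
    keeps the positivity already gained. *)
Lemma pmean_pos (I : finType) (a : I -> {cts X -> R}) (J : pred I) m :
  (forall i x, 0 <= a i x) -> (forall i, J i -> exists x, 0 < a i x) ->
  exists m', forall i, J i -> 0 < m' (a i).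
Proof.
move=> a0 aJ; suff [m' h] : exists m', forall i, i \in enum J -> 0 < m' (a i).
  by exists m' => i Ji; apply: h; rewrite mem_enum.
have : {subset enum J <= J} by move=> i; rewrite mem_enum.
elim: (enum J) => [|i r ih] rJ; first by exists m.
have [i' i'r|m' hm'] := ih; first by apply: rJ; rewrite inE i'r orbT.
have [x ax] := aJ i (rJ i (mem_head _ _)).
have [d dE] := pmean_dirac x.
have [|m'' mE] := @pmean_conv m' d 2^-1; first by lra.
exists m'' => j; rewrite mE inE => /predU1P[->|/hm' mj].
  by have := pmean_ge0 m' (a0 i); rewrite dE; lra.
have : 0 <= d (a j) by rewrite dE.
lra.
Qed.

End pmean_constructions.

(** * Weights dual to the entropy bound *)

Lemma finite_lower_bound (R : realType) (I : finType) (J : pred I) (v : I -> R) :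
  (forall i, J i -> 0 < v i) -> exists2 k, 0 < k & forall i, J i -> k <= v i.
Proof.
move=> v0; exists (\big[Num.min/1]_(i | J i) v i).
  exact: lt_bigmin.
by move=> i Ji; exact: bigmin_le_cond.
Qed.

Section duality.
Variables (R : realType) (X : topologicalType) (I : finType).
Variables (p : I -> R) (a : I -> {cts X -> R}) (T : R).
Hypotheses (p0 : forall i, 0 <= p i) (p1 : \sum_i p i = 1).
Hypothesis a0 : forall i x, 0 <= a i x.
Hypothesis sup_le : forall m : pmean X R,
  (forall i, 0 < p i -> 0 < m (a i)) -> \sum_i p i * ln (m (a i) / p i) <= T.

(* Moving [m] slightly towards [m'] keeps all [m (a i)] away from 0. *)
Lemma regularized_sup_le (m' : pmean X R) (h : R) :
  (forall i, 0 < p i -> 0 < m' (a i)) -> 0 < h ->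
  exists2 e, 0 < e & forall m : pmean X R,
    \sum_i p i * ln ((m (a i) + e) / p i) <= T + h.
Proof.
move=> m'0 h0.
have [k k0 km'] := @finite_lower_bound R I (fun i => 0 < p i) _ m'0.
(* Giving [m'] the share [1 - q] costs at most [- ln q = h] in each logarithm, hence at most [h] in
   the sum, whose weights add up to 1. *)
pose q := expR (- h).
have q0 : 0 < q by exact: expR_gt0.
have q1 : q < 1 by rewrite /q -expR0 ltr_expR oppr_lt0.
have [e e0 eE] : exists2 e, 0 < e & e = (1 - q) * k.
  by exists ((1 - q) * k); rewrite ?mulr_gt0// subr_gt0.
exists e => // m.
have [|m'' mE] := @pmean_conv _ _ m m' (1 - q).
  by apply/andP; split; lra.
have ma i : 0 <= m (a i) by exact: pmean_ge0.
have m''ge i : 0 < p i -> q * (m (a i) + e) <= m'' (a i).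
  move=> pi; rewrite mE subKr eE mulrDr lerD2l mulrCA ler_pM2l ?subr_gt0//.
  have := km' i pi; nra.
have me0 i : 0 < m (a i) + e by rewrite ltr_wpDl.
have m''0 i : 0 < p i -> 0 < m'' (a i).
  by move=> /m''ge; apply: lt_le_trans; rewrite mulr_gt0.
rewrite -lerBlDr (le_trans _ (sup_le m''0))//.
rewrite -[h]mul1r -p1 mulr_suml -sumrB; apply: ler_sum => i _.
rewrite -mulrBr; have [->|pi] := eqVneq (p i) 0; first by rewrite !mul0r.
have {}pi : 0 < p i by rewrite lt_def pi p0.
rewrite ler_wpM2l// addrC -[- h]expRK -/q -lnM ?posrE ?divr_gt0//.
rewrite ler_ln ?posrE ?divr_gt0 ?mulr_gt0 ?invr_gt0 ?m''0//.
by rewrite mulrA ler_pM2r ?invr_gt0// m''ge.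
Qed.

Hypothesis X_compact : compact [set: X].

Lemma entropy_weights (mu : pmean X R) (h : R) : 0 < h ->
  exists c : I -> R, [/\ forall i, 0 < c i,
    forall x, \sum_i c i * a i x <= 1 & - T - h < \sum_i p i * ln (c i)].
Proof.
move=> h0.
have /choice[b b_] : forall i, exists b, 0 < b /\ forall x, a i x <= b.
  by move=> i; have [b ? ?] := @cts_bounded _ _ (a i) X_compact; exists b.
pose S := 1 + \sum_i b i.
have Sb : \sum_i b i < S by rewrite /S ltrDr.
have S0 : 0 < S.
  by rewrite /S ltr_wpDr// sumr_ge0// => i _; rewrite ltW//; case: (b_ i).
have aS x : \sum_i a i x <= S.
  by rewrite (le_trans _ (ltW Sb))// ler_sum// => i _; case: (b_ i).
(* If some [a i0] with [p i0 > 0] vanishes, its weight is unconstrained. *)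
have [[i0 pi0 ai0]|noz] :=
    pselect (exists2 i, 0 < p i & forall x, a i x = 0).
  (* This [Y] makes the weighted sum of the [ln (c i)] equal to [1 - T - h]. *)
  pose Y := (1 - T - h - (1 - p i0) * ln S^-1) / p i0.
  exists (fun i => if i == i0 then expR Y else S^-1); split.
  - by move=> i; case: ifP; rewrite ?expR_gt0// invr_gt0.
  - move=> x; rewrite (_ : \sum_i _ = S^-1 * \sum_i a i x).
      by rewrite mulrC ler_pdivrMr// mul1r.
    rewrite mulr_sumr; apply: eq_bigr => i _.
    by have [->|//] := eqVneq i i0; rewrite ai0 !mulr0.
  - rewrite (bigD1 i0)//= eqxx expRK.
    rewrite (eq_bigr (fun i => p i * ln S^-1)); last first.
      by move=> i /negPf ->.
    rewrite -mulr_suml (_ : \sum_(i | _) p i = 1 - p i0); last first.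
      by have := p1; rewrite (bigD1 i0)//= => <-; rewrite addrAC subrr add0r.
    rewrite /Y mulrC divfK ?gt_eqF//; lra.
have [m' m'0] : exists m' : pmean X R, forall i, 0 < p i -> 0 < m' (a i).
  apply: (@pmean_pos _ _ _ a (fun i => 0 < p i) mu a0) => i pi.
  apply: contrapT => /forallNP ai; apply: noz; exists i => // x.
  by apply/eqP; rewrite eq_le a0 andbT leNgt; apply/negP.
have [|e e0 he] := @regularized_sup_le m' (h / 2) m'0.
  by rewrite divr_gt0.
(* A convex set of value vectors; the shift by [e] supplies the positive lower bound that
   [log_optimal_approx] asks for. *)
pose P := [set v | exists m : pmean X R, v = fun i => m (a i) + e].
(* The regularization loses [h / 2] and the normalization of the weights [2 * g = h / 4], together
   less than [h]. *)
pose g := h / 8.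
have g0 : 0 < g by rewrite divr_gt0.
have [|||_ [m0 ->] opt] := @log_optimal_approx R I p P e (S + e) g p0 p1 e0 g0.
- by exists (fun i => mu (a i) + e), mu.
- move=> v i [m ->]; rewrite lerDr pmean_ge0//= lerD2r pmean_bound// => x.
  by rewrite (le_trans _ (aS x))// (bigD1 i)//= lerDl sumr_ge0.
- move=> v w s [m ->] [m2 ->] s01.
  have [m3 mE] := @pmean_conv _ _ m m2 s s01.
  by exists m3; apply/funext => i; rewrite mE; ring.
pose v i := m0 (a i) + e.
have v0 i : 0 < v i by rewrite ltr_wpDl// pmean_ge0.
(* The term [g / S] makes the weights positive where [p i = 0] and adds at most [g] to the sum;
   near-optimality adds another [g], and the denominator absorbs both. *)
exists (fun i => (p i / v i + g / S) / (1 + 2 * g)).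
have g1 : 0 < 1 + 2 * g by lra.
split.
- by move=> i; rewrite divr_gt0// ltr_wpDl ?divr_gt0// divr_ge0// ltW.
- move=> x; under eq_bigr do rewrite mulrAC.
  rewrite -mulr_suml ler_pdivrMr// mul1r.
  under eq_bigr do rewrite mulrDl.
  rewrite big_split/= -mulr_sumr.
  have : g / S * \sum_i a i x <= g.
    by rewrite mulrAC ler_pdivrMr// ler_pM2l.
  have [d dE] := @pmean_dirac R X x.
  have : \sum_i p i / v i * a i x <= 1 + g.
    rewrite (le_trans _ (opt (fun i => d (a i) + e) _))//; last by exists d.
    apply: ler_sum => i _; rewrite mulrAC -mulrA ler_wpM2l//.
    by rewrite ler_pM2r ?invr_gt0// dE lerDl ltW.
  lra.
- have := he m0.
  rewrite -/(v _) => hem.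
  have : \sum_i p i * (- ln (v i / p i) - 2 * g) <=
     \sum_i p i * ln ((p i / v i + g / S) / (1 + 2 * g)).
    apply: ler_sum => i _; have [->|pi] := eqVneq (p i) 0.
      by rewrite !mul0r.
    have {}pi : 0 < p i by rewrite lt_def pi p0.
    rewrite ler_wpM2l// ln_div ?posrE ?g1 ?addr_gt0 ?divr_gt0//.
    rewrite lerB ?le_ln1Dx//.
      rewrite -lnV ?posrE ?divr_gt0// invf_div.
      by rewrite ler_ln ?posrE ?addr_gt0 ?divr_gt0// lerDl divr_ge0 ?ltW.
    by rewrite (lt_trans _ (_ : 0 < _)) ?ltrN10// mulr_gt0.
  under eq_bigr do rewrite mulrBr mulrN.
  rewrite sumrB sumrN -mulr_suml p1 mul1r.
  apply: lt_le_trans; move: hem; rewrite /v /g; lra.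
Qed.

End duality.

(** * Birkhoff sums and iterates of the transfer operator *)

Section exp_cts.
Variables (R : realType) (X : topologicalType).

Lemma continuous_expR_comp (f : {cts X -> R}) : continuous (expR \o f).
Proof.
by move=> x; apply: continuous_comp; [exact: cts_fun|exact: continuous_expR].
Qed.

Definition exp_cts (f : {cts X -> R}) : {cts X -> R} :=
  mkcts (@continuous_expR_comp f).

Lemma exp_ctsE f x : exp_cts f x = expR (f x).
Proof. by []. Qed.

Variable alpha : {cts X -> X}.

Lemma continuous_comp_iter n (f : {cts X -> R}) : continuous (f \o iter n alpha).
Proof.
elim: n f => [|n ih] f x; first exact: cts_fun.
rewrite (_ : f \o _ = (f \o alpha) \o iter n alpha)//.
exact: (ih (f \o alpha : {cts X -> R})).
Qed.

Definition comp_iter n f : {cts X -> R} := mkcts (@continuous_comp_iter n f).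

(** The filter [J] on times allows splitting the sum by residues mod [N]. *)
Definition birkhoff (J : pred nat) (n : nat) (f : {cts X -> R}) : {cts X -> R} :=
  \sum_(0 <= l < n | J l) comp_iter l f.

Lemma birkhoffE J n f x :
  birkhoff J n f x = \sum_(0 <= l < n | J l) f (iter l alpha x).
Proof. by rewrite cts_sumE. Qed.

Lemma sum_residues (N n : nat) (F : nat -> R) : (0 < N)%N ->
  \sum_(i < N) \sum_(0 <= l < n | (l %% N == i)%N) F l = \sum_(0 <= l < n) F l.
Proof.
move=> N0; rewrite (exchange_big_dep xpredT)//=; apply: eq_bigr => l _.
by rewrite (big_pred1 (Ordinal (ltn_pmod l N0))).
Qed.

Variable A : {linear {cts X -> R} -> {cts X -> R}}.
Hypothesis A_transfer : transfer_operator alpha A.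

Lemma iter_transfer_ge0 n (f : {cts X -> R}) :
  (forall x, 0 <= f x) -> forall x, 0 <= iter n A f x.
Proof. by move=> f0; elim: n => //= n ih; exact: A_transfer.1. Qed.

Lemma iter_transferB n (f g : {cts X -> R}) :
  iter n A (f - g) = iter n A f - iter n A g.
Proof. by elim: n => //= n ->; rewrite linearB. Qed.

Lemma iter_transferZ n a (f : {cts X -> R}) :
  iter n A (a *: f) = a *: iter n A f.
Proof. by elim: n => //= n ->; rewrite linearZ. Qed.

Lemma iter_transfer_sum n (I : Type) (r : seq I) (a : I -> R)
    (F : I -> {cts X -> R}) x :
  iter n A (\sum_(i <- r) a i *: F i) x = \sum_(i <- r) a i * iter n A (F i) x.
Proof.
have -> : iter n A (\sum_(i <- r) a i *: F i) =
    \sum_(i <- r) a i *: iter n A (F i).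
  elim: n => //= n ->; rewrite linear_sum.
  by apply: eq_bigr => i _; rewrite linearZ.
by rewrite cts_sumE.
Qed.

Lemma iter_transfer_le n (f g : {cts X -> R}) :
  (forall x, f x <= g x) -> forall x, iter n A f x <= iter n A g x.
Proof.
move=> fg x; rewrite -subr_ge0.
suff : 0 <= iter n A (g - f) x by rewrite iter_transferB.
by apply: iter_transfer_ge0 => y; have := fg y; rewrite -subr_ge0.
Qed.

Lemma iter_transferE n (f g u : {cts X -> R}) :
  (forall x, u x = f (iter n alpha x) * g x) ->
  forall x, iter n A u x = f x * iter n A g x.
Proof.
elim: n g u => [|n ih] g u uE x; first exact: uE.
rewrite !iterSr (ih (A g))// => y.
have -> : u = (comp_iter n f \o alpha : {cts X -> R}) * g.
  by apply/continuousEP => z; rewrite uE iterSr.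
by rewrite A_transfer.2.
Qed.

Hypothesis X_compact : compact [set: X].

(* Only the times divisible by [N] occur, so [A^N] absorbs one factor
   [exp f] at each step. *)
Lemma iter_transfer_residue0 (N : nat) (f : {cts X -> R}) : (0 < N)%N ->
  (forall x, iter N A (exp_cts f) x <= 1) ->
  exists C : R, forall n x,
    iter n A (exp_cts (birkhoff (fun l => l %% N == 0)%N n f)) x <= C.
Proof.
move=> N0 fN; pose w n := exp_cts (birkhoff (fun l => l %% N == 0)%N n f).
have /choice[b b_] : forall n,
    exists b, 0 < b /\ forall x, iter n A (w n) x <= b.
  by move=> n; have [b ? ?] := cts_bounded (iter n A (w n)) X_compact; exists b.
exists (\sum_(i < N) b i) => n; elim/ltn_ind: n => n ih x.
have [nN|Nn] := ltnP n N.
  rewrite (le_trans ((b_ n).2 x))// (bigD1 (Ordinal nN))//= lerDl.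
  by rewrite sumr_ge0// => i _; rewrite ltW//; exact: (b_ i).1.
(* Time 0 is the only multiple of [N] below [N]; the later ones, shifted by [N], form the sum of
   length [n - N]. *)
have wE y : w n y = w (n - N)%N (iter N alpha y) * exp_cts f y.
  rewrite !exp_ctsE -expRD addrC !birkhoffE -{1}(subnKC Nn); congr expR.
  rewrite (big_cat_nat (n := N))//= ?leq_addr//; congr (_ + _).
    rewrite big_ltn_cond// mod0n eqxx big_nat_cond big_pred0 ?addr0// => l.
    by apply/negP => /andP[/andP[l0 lN]]; rewrite modn_small// gtn_eqF.
  rewrite (big_addn 0 _ N) addKn; apply: eq_big => l; first by rewrite modnDr.
  by rewrite iterD.
rewrite -{1}(subnK Nn) iterD (le_trans _ (ih (n - N)%N _ x))//; last first.
  by rewrite ltn_subrL N0 (leq_trans N0).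
apply: iter_transfer_le => y; rewrite (iter_transferE wE).
by rewrite ler_piMr// ltW// expR_gt0.
Qed.

(** Up to a shift of time by one, class [i.+1] is class [i] composed with [alpha]; one application
    of [A] undoes this at the price of a factor [A 1], bounded by [L]. *)
Lemma iter_transfer_residue (N i : nat) (f : {cts X -> R}) : (i < N)%N ->
  (forall x, iter N A (exp_cts f) x <= 1) ->
  exists C : R, forall n x,
    iter n A (exp_cts (birkhoff (fun l => l %% N == i)%N n f)) x <= C.
Proof.
move=> iN fN; elim: i iN => [|i ih] iN; first exact: iter_transfer_residue0.
have [C hC] := ih (ltnW iN).
have [L L0 hL] := cts_bounded (A 1) X_compact.
exists (Num.max 1 (L * C)) => -[|n] x.
  by rewrite exp_ctsE birkhoffE big_geq// expR0 le_max lexx.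
rewrite le_max; apply/orP; right.
pose w := exp_cts (birkhoff (fun l => l %% N == i)%N n f).
set u := exp_cts _.
have uE y : u y = w (iter 1 alpha y) * (1 : {cts X -> R}) y.
  rewrite mulr1 !exp_ctsE !birkhoffE big_ltn_cond// mod0n/= big_add1/=.
  congr expR; apply: eq_big => l; last by rewrite -iterSr.
  (* If [l.+1] is a multiple of [N], both residue tests fail, because [i.+1 < N]. *)
  rewrite -addn1 -modnDml; have := ltn_pmod l (leq_ltn_trans (leq0n _) iN).
  rewrite addn1 leq_eqVlt => /predU1P[h|/modn_small -> //].
  rewrite h modnn/=; apply/esym/negbTE; apply: contraTneq iN => <-.
  by rewrite h ltnn.
rewrite iterSr (le_trans (iter_transfer_le n (g := L *: w) _ x))//.
  move=> y; rewrite (iter_transferE (n := 1) uE)/= mulrC.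
  by rewrite ler_wpM2r// ltW// expR_gt0.
by rewrite iter_transferZ; exact: (ler_wpM2l (ltW L0) (hC n x)).
Qed.

(* By convexity of [exp], the mean over the [N] residue classes replaces the
   Birkhoff sum over all times by sums over a single class. *)
Lemma iter_transfer_birkhoff_mean (N : nat) (f : {cts X -> R}) : (0 < N)%N ->
  (forall x, iter N A (exp_cts f) x <= 1) ->
  exists C : R, forall n x,
    iter n A (exp_cts (N%:R^-1 *: birkhoff xpredT n f)) x <= C.
Proof.
move=> N0 fN.
have /choice[C hC] : forall i : 'I_N, exists C, forall n x,
    iter n A (exp_cts (birkhoff (fun l => l %% N == i)%N n f)) x <= C.
  by move=> i; exact: iter_transfer_residue.
exists (\sum_i N%:R^-1 * C i) => n x.
pose w i := exp_cts (birkhoff (fun l => l %% N == i)%N n f).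
apply: (@le_trans _ _ (iter n A (\sum_(i < N) N%:R^-1 *: w i) x)); last first.
  by rewrite iter_transfer_sum; apply: ler_sum => i _; rewrite ler_wpM2l// hC.
apply: iter_transfer_le => y; rewrite cts_sumE exp_ctsE.
have -> : (N%:R^-1 *: birkhoff xpredT n f) y =
    \sum_(i < N) N%:R^-1 * birkhoff (fun l => l %% N == i)%N n f y.
  rewrite -mulr_sumr; under eq_bigr do rewrite birkhoffE.
  by rewrite sum_residues// -birkhoffE.
apply: (@expR_convex_comb _ _ (fun=> N%:R^-1)) => [i|]; first by rewrite invr_ge0.
by rewrite sumr_const card_ord -[LHS]mulr_natl divff// pnatr_eq0 -lt0n.
Qed.

End exp_cts.

(** * Weak-* open half-spaces and real bounds extracted from the t-entropy *)

Lemma open_pmean_gt (R : realType) (X : topologicalType) (f : {cts X -> R})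
  (r : R) : open [set m : pmean X R | r < m f].
Proof.
have cf : continuous (fun m : pmean X R => m f).
  rewrite (_ : (fun m => _) = (fun g : {ptws {cts X -> R} -> R} => g f) \o
      @pmean_eval X R)//.
  move=> m; apply: continuous_comp; first exact: initial_continuous.
  exact: (@proj_continuous _ (fun=> R) f).
rewrite (_ : [set m | _] = (fun m : pmean X R => m f) @^-1` [set y | r < y])//.
by apply: open_comp => [m _|]; [exact: cf|exact: open_gt].
Qed.

Section t_entropy_bound.
Variables (R : realType) (X : topologicalType).
Variable A : {linear {cts X -> R} -> {cts X -> R}}.

Lemma t_entropy_lt (mu : pmean X R) (t : R) :
  (t_entropy A mu < t%:E)%E ->
  exists N D, [/\ (0 < N)%N, partition_of_unity D &
    (tau_part A mu N D < (N%:R * t)%:E)%E].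
Proof.
move=> /ereal_inf_lt[_ [N N0 <-]].
have N1 : (0 : R) < N%:R by rewrite ltr0n.
rewrite lte_pdivrMl// -EFinM => /ereal_inf_lt[_ [D Dp <-] h].
by exists N, D.
Qed.

(** The extended supremum is traded for a real bound strictly below [r], even when it is -oo; the
    gap becomes the slack [h] of [entropy_weights]. The condition on [m] keeps every summand finite,
    where [lne] agrees with [ln]. *)
Lemma tau_part_lt (mu : pmean X R) (N : nat) D (r : R) :
  partition_of_unity D -> (tau_part A mu N D < r%:E)%E ->
  exists2 T : R, T < r & forall m : pmean X R,
    (forall g : D, 0 < mu (val g) -> 0 < m (iter N A (val g))) ->
    \sum_(g : D) mu (val g) * ln (m (iter N A (val g)) / mu (val g)) <= T.
Proof.
move=> [D0 _] tr.
have [T Tr tT] : exists2 T : R, T < r & (tau_part A mu N D <= T%:E)%E.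
  case: (tau_part A mu N D) tr => [s| |]//.
    by rewrite lte_fin; exists s.
  by exists (r - 1); rewrite ?leNye// ltrBlDr ltrDl.
exists T => // m mD; rewrite -lee_fin (le_trans _ tT)//.
apply: le_trans (ereal_sup_ubound _); last by exists m.
rewrite big_seq_fsetE/= -sumEFin; apply: lee_sum => g _.
rewrite /tau_summand; case: eqP => [->|/eqP g0]; first by rewrite mul0r.
have gp : 0 < mu (val g).
  by rewrite lt_def g0 pmean_ge0//; apply: D0; exact: fsvalP.
by rewrite lne_EFin ?divr_gt0 ?mD// -EFinM.
Qed.

End t_entropy_bound.

Unset Implicit Arguments.

Theorem theorem9p1 (R : realType) (X : topologicalType)
  (X_hausdorff : hausdorff_space X) (X_compact : compact [set: X])
  (alpha : {cts X -> X}) (A : {linear {cts X -> R} -> {cts X -> R}})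
  (A_transfer : transfer_operator alpha A)
  (mu : pmean X R) (t : R) (t_gt : (t_entropy A mu < t%:E)%E) :
  exists (Omu : set (pmean X R)) (C : R) (chi : nat -> {cts X -> R}),
    nbhs mu Omu /\
    forall (n : nat) (n0 : (0 < n)%N),
      (forall x, \1_(empirical_set alpha n0 Omu) x <= chi n x) /\
      sup_norm (iter n A (chi n)) <= C * expR (n%:R * t).
Proof.
have [N [D [N0 Dp]]] := t_entropy_lt t_gt.
have [D0 D1] := Dp.
move=> /(tau_part_lt Dp)[T TNt supT].
have p0 (g : D) : 0 <= mu (val g).
  by apply: pmean_ge0; apply: D0; exact: fsvalP.
have p1 : \sum_(g : D) mu (val g) = 1.
  by rewrite -(big_seq_fsetE _ _ xpredT mu)/= -linear_sum D1 pmean1.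
have a0 (g : D) x : 0 <= iter N A (val g) x.
  apply: (iter_transfer_ge0 A_transfer); apply: D0; exact: fsvalP.
(* The slack [N%:R * t - T] turns the lower bound [- T - h] into [- (N%:R * t)]. *)
have [|c [c0 cA cT]] := entropy_weights p0 p1 a0 supT
  X_compact mu (h := N%:R * t - T).
  by rewrite subr_gt0.
pose l : {cts X -> R} := \sum_(g : D) ln (c g) *: val g.
have lN x : iter N A (exp_cts l) x <= 1.
  rewrite (le_trans _ (cA x))// -iter_transfer_sum.
  apply: (iter_transfer_le A_transfer) => y.
  have -> : exp_cts l y = expR (\sum_(g : D) val g y * ln (c g)).
    rewrite exp_ctsE cts_sumE; congr expR.
    by apply: eq_bigr => g _; exact: mulrC.
  (* Jensen with the values [val g y] as weights: they sum to 1 since [D] is a partition of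
     unity. *)
  rewrite cts_sumE (le_trans (expR_convex_comb _ _ _))//.
  - by move=> g; apply: D0; exact: fsvalP.
  - rewrite -(big_seq_fsetE _ _ xpredT (fun g : {cts X -> R} => g y)).
    by rewrite -cts_sumE D1.
  - by apply: ler_sum => g _; rewrite lnK ?posrE// [leLHS]mulrC.
have mul : - (N%:R * t) < mu l.
  rewrite (_ : - _ = - T - (N%:R * t - T)); last by ring.
  rewrite (lt_le_trans cT)// linear_sum; apply: ler_sum => g _.
  by rewrite linearZ mulrC.
have [C hC] := iter_transfer_birkhoff_mean A_transfer X_compact N0 lN.
exists [set m | - (N%:R * t) < m l], C,
  (fun n => expR (n%:R * t) *: exp_cts (N%:R^-1 *: birkhoff alpha xpredT n l)).
split; first by apply: open_nbhs_nbhs; split; [exact: open_pmean_gt|].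
move=> n n0; split=> [x|].
  rewrite indicE; case: (boolP (x \in _)) => [/set_mem|_]; last first.
    by rewrite mulr_ge0// ltW// expR_gt0.
  rewrite /empirical_set/= /empirical_fun => xO.
  rewrite [leRHS](_ : _ = expR (n%:R * t) *
    expR (N%:R^-1 * birkhoff alpha xpredT n l x))//.
  rewrite -expRD -[leLHS]expR0 ler_expR birkhoffE big_mkord.
  move: xO; set s := \sum_(i < n) _ => xO.
  have n1 : (0 : R) < n%:R by rewrite ltr0n.
  have N1 : (0 : R) < N%:R by rewrite ltr0n.
  (* Membership of the empirical measure bounds the Birkhoff sum [s] from below, so the exponent
     [n t + s / N] is positive. *)
  have h : - (N%:R * t) * n%:R < s by rewrite -ltr_pdivlMr// [s / _]mulrC.
  rewrite -(ler_pM2l N1) mulr0 mulrDr mulVKf ?gt_eqF//; nra.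
(* The existence of [mu] excludes an empty [X], so the supremum is over a nonempty set. *)
apply: ge_sup; first by apply: image_nonempty; exact: pmean_nonempty mu.
have e0 : 0 <= expR (n%:R * t) by exact: expR_ge0.
move=> _ [x _ <-]; rewrite ger0_norm; last first.
  apply: (iter_transfer_ge0 A_transfer) => y.
  exact: (mulr_ge0 e0 (expR_ge0 _)).
rewrite iter_transferZ [leRHS]mulrC.
exact: (ler_wpM2l e0 (hC n x)).
Qed.
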